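(* Consider a scalar conservation law $\partial_tu+\nabla\cdot f(u)=0$ with $B=[m,M]$. If $$\lambda a_0\le c_{\mathcal G},$$ then, for every cell $K$ and each choice of sign, $$u_h\in B\text{ on }S_K\quad\Longrightarrow\quad\overline{u_h\pm\Delta t\,\mathcal G(u_h)}_K\in B .$$
   Context: $f$ is the flux function, with values in $\mathbb R^d$ and derivative $\partial_u f$. $B=[m,M]$ is the invariant interval given by the maximum principle. $\mathcal T_h=\{K\}$ is a mesh of $\Omega\subset\mathbb R^d$; each cell $K$ has edges $e_{\ell,K}$, $\ell=1,\dots,l(K)$, forming $\partial K$, with unit outer normals $\nu_{\ell,K}$ (constant on each edge); $|e_{\ell,K}|:=1$ if $d=1$. $V_h=\{v\in L^2(\Omega): v|_K\in Z^k(K)\ \forall K\}$, where $k\ge1$ and $Z^k(K)$ is the space of polynomials on $K$ of degree $\le k$, or of degree $\le k$ in each variable; $u_h\in V_h$, $u_h^{\rm int}$ is the interior trace on $e_{\ell,K}$, and $\overline v_K=\frac1{|K|}\int_Kv\,dx$ is the cell average. Quadrature: edge integrals are approximated by $\int_{e_{\ell,K}}v\,dl\approx|e_{\ell,K}|\sum_{\beta=1}^{s_\ell}\omega^{\rm B}_{\beta,\ell,K}v(x_{\beta,\ell,K})$, a rule that is exact for constants, i.e. $\sum_{\beta=1}^{s_\ell}\omega^{\rm B}_{\beta,\ell,K}=1$. There is a convex decomposition of the cell average that includes all these edge quadrature points: for all $v\in Z^k(K)$, $\overline v_K=\sum_{\alpha=1}^{s_K}\omega^{\rm I}_{\alpha,K}v(x_{\alpha,K})+\sum_{\ell=1}^{l(K)}\sum_{\beta=1}^{s_\ell}\omega^{\rm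 I}_{\beta,\ell,K}v(x_{\beta,\ell,K})$ with $0<\omega^{\rm I}_{\alpha,K},\omega^{\rm I}_{\beta,\ell,K}<1$ (hence these weights sum to 1). $S_K=\{x_{\alpha,K},x_{\beta,\ell,K}\}$ is the set of points in this decomposition; ''$u_h\in B$ on $S_K$'' means $u_h(x_{\alpha,K})\in B$ and $u_h^{\rm int}(x_{\beta,\ell,K})\in B$ for all $\alpha,\beta,\ell$. Local derivative operator: $\mathcal G(u_h)=-\nabla^{\rm loc}\cdot f(u_h)\in V_h$, where for all $v_h\in V_h$ and all $K$, $\int_K[\nabla^{\rm loc}\cdot f(u_h)]v_h\,dx=-\int_Kf(u_h)\cdot\nabla v_h\,dx+\sum_{\ell=1}^{l(K)}\int_{e_{\ell,K}}(f(u_h^{\rm int})\cdot\nu_{\ell,K})v_h\,dl$, with edge integrals computed by the quadrature above. Constants: $\Delta t$ is the time step size; $\lambda=\max_{\ell,K}\Delta t\,|e_{\ell,K}|/|K|$; $a_0=\max_{x,\ell,K}|\mathrm{eig}(\partial_uf(u)\cdot\nu_{\ell,K})|$, the maximum over points $x$ (with $u$ the solution value at $x$), edges $\ell$ and cells $K$ of the wave speed, which in the scalar case is $|\partial_uf(u)\cdot\nu_{\ell,K}|$; $c_{\mathcal G}=\min_{\beta,\ell,K}\omega^{\rm I}_{\beta,\ell,K}/\omega^{\rm B}_{\beta,\ell,K}$. *)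

(* Defs.v *)
From HB Require Import structures.
From mathcomp Require Import all_boot all_order all_algebra.
From mathcomp Require Import all_classical all_reals all_analysis.

Set Implicit Arguments.
Unset Strict Implicit.
Unset Printing Implicit Defensive.

Import Order.TTheory GRing.Theory Num.Theory.
Import numFieldNormedType.Exports.

Local Open Scope classical_set_scope.
Local Open Scope ring_scope.

(* d-dimensional Lebesgue measure.  The library has the product sigma-algebra
   on d.-tuple R but no measure on it, so the measure is the iterated product of
   the one-dimensional one.  Topology and linear algebra live on 'rV[R]_d, which
   is identified with d.-tuple R coordinatewise by row_of_tuple. *)

Definition tuple_cons (T : Type) (n : nat) (p : T * n.-tuple T) :
  n.+1.-tuple T := [tuple of p.1 :: p.2].

Section ProductStep.
Context {R : realType} {n : nat}.
Local Notation tupR m := (m.-tuple (measurableTypeR R)).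
Variable mu : {sigma_finite_measure set (tupR n) -> \bar R}.

Let measurable_tuple_cons :
  measurable_fun setT (@tuple_cons (measurableTypeR R) n).
Proof. exact: measurable_cons. Qed.

Definition lebesgue_step : set (tupR n.+1) -> \bar R :=
  pushforward (lebesgue_measure \x mu)%E (@tuple_cons (measurableTypeR R) n).

Let lebesgue_step0 : lebesgue_step set0 = 0%E.
Proof. by rewrite /lebesgue_step /pushforward preimage_set0 measure0. Qed.

Let lebesgue_step_ge0 A : (0 <= lebesgue_step A)%E.
Proof. exact: measure_ge0. Qed.

Let lebesgue_step_sigma_additive : semi_sigma_additive lebesgue_step.
Proof.
move=> F mF tF mUF; rewrite /lebesgue_step /pushforward preimage_bigcup.
have mpre A : measurable A ->
    measurable (@tuple_cons (measurableTypeR R) n @^-1` A).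
  by move=> mA; rewrite -[X in measurable X]setTI; exact: measurable_tuple_cons.
apply: measure_semi_sigma_additive.
- by move=> i; exact: mpre.
- apply/trivIsetP => /= i j _ _ ij; rewrite -preimage_setI.
  by move/trivIsetP : tF => /(_ _ _ _ _ ij) ->//; rewrite preimage_set0.
- by rewrite -preimage_bigcup; exact: mpre.
Qed.

HB.instance Definition _ := isMeasure.Build _ _ _ lebesgue_step
  lebesgue_step0 lebesgue_step_ge0 lebesgue_step_sigma_additive.

Let lebesgue_step_sigma_finite : sigma_finite setT lebesgue_step.
Proof.
pose uncons (t : tupR n.+1) : measurableTypeR R * tupR n :=
  (thead t, [tuple of behead t]).
have munc : measurable_fun setT uncons.
  apply/measurable_fun_pair; first exact: measurable_tnth.
  exact: measurable_behead.
have consK : cancel (@tuple_cons (measurableTypeR R) n) uncons.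
  by case=> x t; rewrite /uncons/=; congr pair; apply/val_inj.
have /sigma_finiteP[F [TF ndF Foo]] := sigma_finiteT (@lebesgue_measure R).
have /sigma_finiteP[G [TG ndG Goo]] := sigma_finiteT mu.
exists (fun i => uncons @^-1` (F i `*` G i)).
  rewrite -preimage_bigcup (_ : \bigcup_i _ = setT) ?preimage_setT//.
  rewrite -subTset => -[x y] _.
  have [i _ Fx] : (\bigcup_i F i) x by rewrite -TF.
  have [j _ Gy] : (\bigcup_i G i) y by rewrite -TG.
  exists (maxn i j) => //; split.
  - by move: x Fx; exact/subsetPset/ndF/leq_maxl.
  - by move: y Gy; exact/subsetPset/ndG/leq_maxr.
move=> i; have [mF Fi] := Foo i; have [mG Gi] := Goo i; split.
  by rewrite -[X in measurable X]setTI; apply: munc => //; exact: measurableX.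
rewrite /= /lebesgue_step /pushforward -comp_preimage.
rewrite (_ : uncons \o _ = id) ?preimage_id; last first.
  by apply/funext => p /=; rewrite consK.
by rewrite product_measure1E// lte_mul_pinfty// ge0_fin_numE.
Qed.

HB.instance Definition _ := Measure_isSigmaFinite.Build _ _ _ lebesgue_step
  lebesgue_step_sigma_finite.

End ProductStep.

Fixpoint lebesgue_tuple (R : realType) (n : nat) :
    {sigma_finite_measure set (n.-tuple (measurableTypeR R)) -> \bar R} :=
  if n is m.+1
  return {sigma_finite_measure set (n.-tuple (measurableTypeR R)) -> \bar R}
  then lebesgue_step (lebesgue_tuple R m)
  else dirac [tuple].

Section Geometry.
Context {R : realType} {d : nat}.
Local Notation point := 'rV[R]_d.

Definition row_of_tuple (t : d.-tuple (measurableTypeR R)) : point :=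
  \row_i tnth t i.

Definition volume (A : set point) : R :=
  fine (lebesgue_tuple R d (row_of_tuple @^-1` A)).

Definition volume_null (A : set point) : Prop :=
  (lebesgue_tuple R d).-negligible (row_of_tuple @^-1` A).

Definition volume_integral (A : set point) (g : point -> R) : R :=
  \int[lebesgue_tuple R d]_(t in row_of_tuple @^-1` A) g (row_of_tuple t).

Definition dot (x y : point) : R := \sum_i x ord0 i * y ord0 i.

Definition gradient (v : point -> R) (x : point) : point :=
  \row_i 'D_(delta_mx ord0 i : point) v x.

(* For e contained in a hyperplane with unit normal nu, the right prism over e
   of height 1 has d-dimensional volume equal to the (d-1)-dimensional measure
   of e.  For d = 1 and e a point, this is the length 1 of a unit segment. *)
Definition prism (e : set point) (nu : point) : set point :=
  [set x + t *: nu | x in e & t in `[0, 1]].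

Definition surface_measure (e : set point) (nu : point) : R :=
  volume (prism e nu).

Definition surface_null (e : set point) (nu : point) : Prop :=
  volume_null (prism e nu).

(* x is a boundary point at which K coincides, near x, with the half-space on
   the inner side of the hyperplane through x with normal nu. *)
Definition outer_normal_at (K : set point) (nu x : point) : Prop :=
  \forall y \near x, K y <-> dot (y - x) nu <= 0.

(* A (not necessarily convex) polytopal cell.  Outwardness of the normals is
   required almost everywhere on each edge, since it fails where edges meet. *)
Record cell := Cell {
  cell_set :> set point;
  nedges : nat;
  edge : 'I_nedges -> set point;
  normal : 'I_nedges -> point;
  cell_compact : compact cell_set;
  cell_regular : cell_set = closure (interior cell_set);
  cell_nonempty : interior cell_set !=set0;
  cell_connected : connected (interior cell_set);
  cell_boundary : cell_set `\` interior cell_set = \bigcup_l edge l;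
  edge_closed : forall l, closed (edge l);
  normal_unit : forall l, dot (normal l) (normal l) = 1;
  edge_flat : forall l, exists c, forall x, edge l x -> dot x (normal l) = c;
  edge_outer : forall l,
    surface_null (edge l `\` outer_normal_at cell_set (normal l)) (normal l);
  edge_overlap : forall l l', l != l' ->
    surface_null (edge l `&` edge l') (normal l) }.

Definition edge_size (K : cell) (l : 'I_(nedges K)) : R :=
  surface_measure (edge l) (normal l).

Record mesh (Omega : set point) := Mesh {
  ncells : nat;
  mesh_cell :> 'I_ncells -> cell;
  mesh_cover : closure Omega = \bigcup_K (mesh_cell K : set point);
  mesh_disjoint : forall K K', K != K' ->
    interior (mesh_cell K) `&` interior (mesh_cell K') = set0 }.

Definition cell_average (K : set point) (v : point -> R) : R :=
  (volume K)^-1 * volume_integral K v.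

(* The two choices of Z^k: degree <= k in total, or in each variable. *)
Inductive degree_kind := TotalDegree | DegreePerVariable.

Definition polynomials (Z : degree_kind) (k : nat) : set (point -> R) :=
  [set p | exists c : {ffun 'I_d -> 'I_k.+1} -> R,
    (forall a : {ffun 'I_d -> 'I_k.+1},
      Z = TotalDegree -> (k < \sum_i a i)%N -> c a = 0) /\
    forall x : point, p x = \sum_(a : {ffun 'I_d -> 'I_k.+1})
      c a * \prod_i x ord0 i ^+ a i].

End Geometry.

Arguments cell : clear implicits.
Arguments mesh {R d} Omega.

Section Scheme.
Context {R : realType} {d : nat} {Omega : set 'rV[R]_d}.
Variables (T : mesh Omega) (k : nat) (Z : 'I_(ncells T) -> degree_kind).
Local Notation point := 'rV[R]_d.

(* An element of V_h is given by its polynomial on each cell; the interior trace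
   on an edge of K is then the value of the polynomial of K. *)
Definition dg_function := 'I_(ncells T) -> point -> R.

Definition dg_space : set dg_function :=
  [set v | forall K, polynomials (Z K) k (v K)].

Record quadrature := Quadrature {
  edge_npts : forall K, 'I_(nedges (T K)) -> nat;
  edge_pt : forall K (l : 'I_(nedges (T K))), 'I_(edge_npts l) -> point;
  wB : forall K (l : 'I_(nedges (T K))), 'I_(edge_npts l) -> R;
  int_npts : 'I_(ncells T) -> nat;
  int_pt : forall K, 'I_(int_npts K) -> point;
  wI_int : forall K, 'I_(int_npts K) -> R;
  wI_edge : forall K (l : 'I_(nedges (T K))), 'I_(edge_npts l) -> R;
  edge_ptP : forall K (l : 'I_(nedges (T K))) (b : 'I_(edge_npts l)),
    edge l (edge_pt b);
  int_ptP : forall K (a : 'I_(int_npts K)), cell_set (T K) (int_pt a);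
  wB_sum : forall K (l : 'I_(nedges (T K))),
    \sum_(b < edge_npts l) wB b = 1;
  wI_int_itv : forall K (a : 'I_(int_npts K)), 0 < wI_int a < 1;
  wI_edge_itv : forall K (l : 'I_(nedges (T K))) (b : 'I_(edge_npts l)),
    0 < wI_edge b < 1;
  average_decomposition : forall K (v : point -> R),
    polynomials (Z K) k v ->
    cell_average (T K) v =
      \sum_(a < int_npts K) wI_int a * v (int_pt a) +
      \sum_(l < nedges (T K)) \sum_(b < edge_npts l)
        wI_edge b * v (edge_pt b) }.

Variable Q : quadrature.

Definition edge_quadrature (K : 'I_(ncells T)) (l : 'I_(nedges (T K)))
    (g : point -> R) : R :=
  edge_size l * \sum_(b < edge_npts Q l) wB b * g (edge_pt b).

Definition is_local_divergence (f : R -> point) (u D : dg_function) : Prop :=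
  dg_space D /\
  forall v, dg_space v -> forall K,
    volume_integral (T K) (fun x => D K x * v K x) =
      - volume_integral (T K) (fun x => dot (f (u K x)) (gradient (v K) x)) +
      \sum_(l < nedges (T K))
        edge_quadrature l (fun x => dot (f (u K x)) (normal l) * v K x).

(* The identity determines G among elements of V_h, because the mass matrix of
   Z^k(K) is invertible. *)
Definition is_local_derivative_operator (f : R -> point)
    (u G : dg_function) : Prop :=
  exists2 D, is_local_divergence f u D & G = fun K x => - D K x.

Definition valued_on_SK (B : set R) (K : 'I_(ncells T)) (u : dg_function) :
    Prop :=
  (forall a : 'I_(int_npts Q K), B (u K (int_pt a))) /\
  (forall (l : 'I_(nedges (T K))) (b : 'I_(edge_npts Q l)),
     B (u K (edge_pt b))).

(* In the three constants, the index sets are finite or (for the points x)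
   finite unions of compact cells, so that sup and inf are max and min. *)

Definition mesh_ratio (dt : R) : R :=
  sup [set r | exists K (l : 'I_(nedges (T K))),
    r = dt * edge_size l / volume (T K)].

Definition max_wave_speed (f : R -> point) (u : dg_function) : R :=
  sup [set r | exists K' x K (l : 'I_(nedges (T K))),
    cell_set (T K') x /\ r = `|dot (derive1 f (u K' x)) (normal l)|].

Definition decomposition_constant : R :=
  inf [set r | exists K (l : 'I_(nedges (T K))) (b : 'I_(edge_npts Q l)),
    r = wI_edge b / wB b].

End Scheme.

(* Main.v *)
Require Import Defs.
From mathcomp Require Import all_boot all_order all_algebra.
From mathcomp Require Import all_classical all_reals all_analysis.
From mathcomp Require Import ring lra measurable_realfun.
Import Order.TTheory GRing.Theory Num.Theory.
Import numFieldNormedType.Exports.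
Local Open Scope classical_set_scope.
Local Open Scope ring_scope.

Set Implicit Arguments.
Unset Strict Implicit.
Unset Printing Implicit Defensive.

(** Testing the scheme with the constant 1 turns the average of G(u_h) over K
    into minus the sum of the edge fluxes divided by |K|, while the average of
    u_h is the convex combination of its values on S_K.  Let c be the minimum of
    u_h on S_K.  Since sum_l |e_l| nu_l = 0, f(c) may be subtracted from every
    flux; as c is a value of u_h on the connected set K, the mean value theorem
    bounds the remaining flux at an edge point by a_0 (u_h - c), and under the
    CFL condition the weight of that point absorbs it.  Hence the new average is
    at least c; the maximum is treated in the same way.

    The identity sum_l |e_l| nu_l = 0 is proved one coordinate i at a time.
    Almost every line in direction i meets the boundary of K only at points
    interior to a single edge and transversal to it, and it leaves the compact
    set K as often as it enters.  Integrating this over the slab 0 <= x_i <= 1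
    gives the identity, because the part of the slab on the lines through e_l
    has measure |e_l| |nu_(l,i)|: it is the preimage of the prism over e_l under
    an affine map composed of maps that change a single coordinate, and for
    those the effect on Lebesgue measure is given by Fubini's theorem. *)

(** * Lebesgue measure under affine changes of one coordinate *)

(** The pushforward of Lebesgue measure under the map, scaled by [|a|], agrees with Lebesgue measure
    on half-open intervals, so uniqueness identifies the two. *)
Lemma lebesgue_measure_affine (R : realType) (a b : R) (A : set R) :
  a != 0 -> measurable A ->
  lebesgue_measure ((fun x => a * x + b) @^-1` A) =
    (`|a|^-1%:E * lebesgue_measure A)%E.
Proof.
move=> a0 mA.
have mf : @measurable_fun _ _ (measurableTypeR R) (measurableTypeR R) setT
    (fun x => a * x + b).
  by apply: measurable_funD => //; exact: mulrl_measurable.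
pose f (x : measurableTypeR R) : measurableTypeR R := a * x + b.
pose s := NngNum (normr_ge0 a).
pose mu' : {measure set (measurableTypeR R) -> \bar R} :=
  mscale s (pushforward (@lebesgue_measure R) f).
pose mu := mu' mf.
have muE X : mu X =
    (`|a|%:E * lebesgue_measure ((fun x => a * x + b)%R @^-1` X))%E by [].
have -> : lebesgue_measure A = mu A.
  apply: lebesgue_measure_unique => // _ [[x y] /= _ <-]; rewrite muE.
  (* For [a < 0] the preimage of []x, y]] is closed on the left and open on the right, so lengths
     are needed for several kinds of endpoints; the maximum covers empty intervals. *)
  have itvE (c d : bool) (u v : R) : (lebesgue_measure
      [set` Interval (BSide c u) (BSide d v)] =
      (Num.max (v - u) 0)%:E)%E.
    rewrite lebesgue_measure_itv/= lte_fin; case: ltP => uv.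
      by rewrite -EFinD; congr EFin; rewrite max_l// subr_ge0 ltW.
    by congr EFin; rewrite max_r// subr_le0.
  have [a_gt0|a_lt0|/eqP] := ltgtP 0 a; last by rewrite eq_sym (negbTE a0).
    rewrite [X in (_ * lebesgue_measure X)%E](_ : _ =
        `](x - b) / a, (y - b) / a]%classic).
      rewrite !itvE gtr0_norm// -EFinM; congr EFin.
      rewrite maxr_pMr ?ltW// mulr0; congr Num.max.
      by field; rewrite gt_eqF.
    apply/seteqP; split => z /=; rewrite !in_itv/= ltr_pdivrMr// ler_pdivlMr//;
    rewrite ltrBlDr lerBrDr; by rewrite mulrC.
  rewrite [X in (_ * lebesgue_measure X)%E](_ : _ =
      `[(y - b) / a, (x - b) / a[%classic).
    rewrite !itvE ltr0_norm// -EFinM; congr EFin.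
    rewrite maxr_pMr ?oppr_ge0 ?ltW// mulr0; congr Num.max.
    by field; rewrite lt_eqF.
  apply/seteqP; split => z /=; rewrite !in_itv/= ltr_ndivlMr// ler_ndivrMr//;
    by rewrite ltrBlDr lerBrDr (mulrC z) andbC.
by rewrite muE muleA -EFinM mulVf ?normr_eq0// mul1e.
Qed.

Lemma lebesgue_tuple0E (R : realType) (n : nat)
    (A : set (n.+1.-tuple (measurableTypeR R))) :
  lebesgue_tuple R n.+1 A =
  (lebesgue_measure \x lebesgue_tuple R n)%E (@tuple_cons R n @^-1` A).
Proof. by []. Qed.

Lemma measurable_tuple_cons (R : realType) (n : nat) :
  measurable_fun setT (@tuple_cons (measurableTypeR R) n).
Proof. exact: measurable_cons. Qed.

Lemma tnth_tuple_cons0 (T : Type) n (p : T * n.-tuple T) :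
  tnth (tuple_cons p) ord0 = p.1.
Proof. by []. Qed.

Lemma tnth_tuple_consS (T : Type) n (p : T * n.-tuple T) i :
  tnth (tuple_cons p) (lift ord0 i) = tnth p.2 i.
Proof. exact: tnthS. Qed.

Lemma tnth_behead_tuple (T : Type) n (t : n.+1.-tuple T) (i : 'I_n) :
  tnth [tuple of behead t] i = tnth t (lift ord0 i).
Proof. by rewrite [in RHS](tuple_eta t) tnthS. Qed.

(** By Fubini's theorem the claim reduces to lines in direction [j], on which [T] is a
    one-dimensional affine map because [g] is constant there. Induction on [n] strips off leading
    coordinates until [j] comes first. *)
Lemma lebesgue_tuple_affine (R : realType) (n : nat) (j : 'I_n) (a : R)
    (g : n.-tuple (measurableTypeR R) -> R)
    (T : n.-tuple (measurableTypeR R) -> n.-tuple (measurableTypeR R)) :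
  a != 0 -> measurable_fun setT g ->
  (forall t t', (forall i, i != j -> tnth t i = tnth t' i) -> g t = g t') ->
  (forall t i, i != j -> tnth (T t) i = tnth t i) ->
  (forall t, tnth (T t) j = a * tnth t j + g t) ->
  measurable_fun setT T /\
  forall A, measurable A ->
    lebesgue_tuple R n (T @^-1` A) = (`|a|^-1%:E * lebesgue_tuple R n A)%E.
Proof.
move=> a0; elim: n j g T => [|n IH] j g T mg gj Ti Tj; first by have := ltn_ord j.
have mT : measurable_fun setT T.
  apply/measurable_fun_tnthP => i; have [->|ij] := eqVneq i j.
    rewrite (_ : _ \o _ = (fun t => a * tnth t j + g t)); last first.
      by apply/funext => t /=; rewrite Tj.
    apply: measurable_funD => //.
    apply: (@measurableT_comp _ _ _ _ _ _ (fun x : measurableTypeR R => a * x)).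
      exact: mulrl_measurable.
    exact: measurable_tnth.
  rewrite (_ : _ \o _ = @tnth _ _ ^~ i); first exact: measurable_tnth.
  by apply/funext => t /=; rewrite Ti.
split=> // A mA.
have mcA : measurable (@tuple_cons R n @^-1` A).
  by rewrite -[X in measurable X]setTI; exact: measurable_tuple_cons.
have mTA : measurable (T @^-1` A).
  by rewrite -[X in measurable X]setTI; exact: mT.
have mcTA : measurable (@tuple_cons R n @^-1` (T @^-1` A)).
  by rewrite -[X in measurable X]setTI; exact: measurable_tuple_cons.
rewrite !lebesgue_tuple0E.
have [j0|[j' jE]] : j = ord0 \/ exists j', j = lift ord0 j'.
  by case: (unliftP ord0 j) => [j1 ->|]; [right; exists j1|left].
- pose B := @tuple_cons R n @^-1` A.
  (* The product measure unfolds to an integral over the first coordinate, but here [T] acts on that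
     coordinate; Tonelli's theorem swaps the order. *)
  have fubini C : measurable C -> (lebesgue_measure \x lebesgue_tuple R n)%E C =
      (\int[lebesgue_tuple R n]_y (lebesgue_measure \o ysection C) y)%E.
    move=> mC; rewrite -(indic_fubini_tonelli_GE _ mC).
    by rewrite -indic_fubini_tonelli// indic_fubini_tonelli_FE.
  rewrite !fubini//.
  rewrite -ge0_integralZl_EFin//; last exact: measurable_fun_ysection.
  apply: eq_integral => y _ /=.
  (* The entry [0] is a placeholder for the first coordinate, on which [g] does not depend. *)
  rewrite -(lebesgue_measure_affine (g (tuple_cons (0, y))))//; last first.
    exact: measurable_ysection.
  congr lebesgue_measure; apply/seteqP.
  suff TE x : T (tuple_cons (x, y)) =
      tuple_cons (a * x + g (tuple_cons (0, y)), y).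
    by split => x; rewrite /ysection/= !inE/= TE.
  apply: eq_from_tnth => i; case: (unliftP ord0 i) => [i' ->|->].
    by rewrite Ti ?j0// !tnth_tuple_consS.
  rewrite -{1}j0 Tj j0 !tnth_tuple_cons0/=; congr (_ + _).
  apply: gj => i'; case: (unliftP ord0 i') => [i'' ->|->]; rewrite ?j0 ?eqxx//.
  by rewrite !tnth_tuple_consS.
(* Now [T] preserves the first coordinate [x], so the induction hypothesis applies to each slice
   with [x] fixed. *)
- rewrite -ge0_integralZl_EFin//; last exact: measurable_fun_xsection.
  apply: eq_integral => x _ /=.
  pose Tx (y : n.-tuple (measurableTypeR R)) : n.-tuple (measurableTypeR R) :=
    [tuple of behead (T (tuple_cons (x, y)))].
  have TxE y i : tnth (Tx y) i = tnth (T (tuple_cons (x, y))) (lift ord0 i).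
    exact: tnth_behead_tuple.
  have [||||_ <-] := IH j' (fun y => g (tuple_cons (x, y))) Tx.
  + apply: measurableT_comp => //.
    exact: (measurable_fun_pair2 x (@measurable_tuple_cons R n)).
  + move=> y y' yy'; apply: gj => i.
    case: (unliftP ord0 i) => [i' ->|->]; last by rewrite !tnth_tuple_cons0.
    by rewrite jE (inj_eq lift_inj) !tnth_tuple_consS; exact: yy'.
  + by move=> y i ij; rewrite TxE Ti ?tnth_tuple_consS// jE (inj_eq lift_inj).
  + by move=> y; rewrite TxE -jE Tj jE tnth_tuple_consS.
  + congr (lebesgue_tuple R n _); apply/seteqP.
    suff TE y : T (tuple_cons (x, y)) = tuple_cons (x, Tx y).
      by split => y; rewrite /xsection/= !inE/= TE.
    apply: eq_from_tnth => i; case: (unliftP ord0 i) => [i' ->|->].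
      by rewrite tnth_tuple_consS TxE.
    by rewrite Ti ?jE// tnth_tuple_cons0.
  + exact: measurable_xsection.
Qed.

Lemma lebesgue_tuple_box (R : realType) (n : nat) (c : 'I_n -> R) (r : R) :
  0 < r ->
  measurable [set t : n.-tuple (measurableTypeR R) |
    forall i, `|c i - tnth t i| < r] /\
  lebesgue_tuple R n [set t | forall i, `|c i - tnth t i| < r] =
    ((r *+ 2) ^+ n)%:E.
Proof.
move=> r0; elim: n c => [|n IH] c.
  rewrite [X in measurable X](_ : _ = setT); last first.
    by apply/seteqP; split => // t _ [].
  split; first exact: measurableT.
  by rewrite /= diracE mem_set//= => -[].
have [mB BE] := IH (fun i => c (lift ord0 i)).
set B := [set t | _] in mB BE.
have preE : @tuple_cons (measurableTypeR R) n @^-1`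
    [set t | forall i, `|c i - tnth t i| < r] = ball (c ord0) r `*` B.
  apply/seteqP; split => -[x t] /=.
    move=> xt; split; first exact: (xt ord0).
    by move=> i; have := xt (lift ord0 i); rewrite tnth_tuple_consS.
  move=> [xc tB] i; case: (unliftP ord0 i) => [i' ->|->//].
  by rewrite tnth_tuple_consS; exact: tB.
split; last first.
  rewrite lebesgue_tuple0E preE product_measure1E//; last exact: measurable_ball.
  by rewrite [X in (X * _)%E](lebesgue_measure_ball _ (ltW r0)) exprS EFinM BE.
rewrite [X in measurable X](_ : _ =
    (fun t => tnth t ord0) @^-1` ball (c ord0) r `&`
    (fun t : n.+1.-tuple (measurableTypeR R) => [tuple of behead t]) @^-1` B).
  apply: measurableI; rewrite -[X in measurable X]setTI.
    by apply: measurable_tnth => //; exact: measurable_ball.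
  exact: measurable_behead.
apply/seteqP; split => t /=.
  move=> tr; split; first exact: tr.
  by move=> i; rewrite tnth_behead_tuple; exact: tr.
move=> [t0 tB] i; case: (unliftP ord0 i) => [i' ->|->//].
by have := tB i'; rewrite tnth_behead_tuple.
Qed.

Lemma lebesgue_tuple_coord0 (R : realType) (n : nat) (j : 'I_n) :
  lebesgue_tuple R n [set t | tnth t j = 0] = 0%E.
Proof.
elim: n j => [|n IH] j; first by case: j.
rewrite lebesgue_tuple0E; case: (unliftP ord0 j) => [j' ->|->].
  rewrite (_ : _ @^-1` _ = setT `*` [set t | tnth t j' = 0]); last first.
    apply/seteqP; split => -[x t] /=; rewrite tnth_tuple_consS => //.
    by case.
  rewrite product_measure1E ?IH ?mule0//.
  rewrite -[X in measurable X]setTI.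
  exact: (@measurable_tnth _ (measurableTypeR R) n j' measurableT [set 0]
    (measurable_set1 _)).
rewrite (_ : _ @^-1` _ = [set 0] `*` setT); last first.
  by apply/seteqP; split => -[x t] //= [].
rewrite product_measure1E//.
(* The second factor may have infinite measure; the product is still zero by the convention
   [0 * +oo = 0]. *)
transitivity (0 * lebesgue_tuple R n setT)%E; last exact: mul0e.
by congr (_ * _)%E; exact: lebesgue_measure_set1.
Qed.

(** * Cylinders over flat sets *)

Section LebesgueRow.
Context {R : realType} {d : nat}.
Local Notation point := 'rV[R]_d.

Definition lebesgue_row (A : set point) : \bar R :=
  lebesgue_tuple R d (row_of_tuple @^-1` A).

Definition row_measurable (A : set point) : Prop :=
  measurable (row_of_tuple @^-1` A).

Definition tuple_of_row (x : point) : d.-tuple (measurableTypeR R) :=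
  [tuple x ord0 i | i < d].

Lemma tuple_of_rowK : cancel tuple_of_row row_of_tuple.
Proof. by move=> x; apply/rowP => i; rewrite mxE tnth_mktuple. Qed.

Lemma row_of_tupleK : cancel row_of_tuple tuple_of_row.
Proof. by move=> t; apply: eq_from_tnth => i; rewrite tnth_mktuple mxE. Qed.

Lemma row_ext (x y : point) : (forall k, x ord0 k = y ord0 k) -> x = y.
Proof. by move=> xy; apply/rowP => k; exact: xy. Qed.

(** The factor refers to preimages: for an affine bijection it is the reciprocal of the absolute
    value of the determinant. *)
Definition scales (c : R) (T : point -> point) : Prop :=
  forall A, row_measurable A -> row_measurable (T @^-1` A) /\
    lebesgue_row (T @^-1` A) = (c%:E * lebesgue_row A)%E.

Lemma scales_id : scales 1 id.
Proof. by move=> A mA; rewrite mul1e. Qed.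

Lemma scales_comp (b c : R) (S T : point -> point) :
  scales b S -> scales c T -> scales (b * c) (T \o S).
Proof.
move=> sS sT A mA; have [mTA TA] := sT A mA; have [mSTA STA] := sS _ mTA.
by split=> //; rewrite EFinM -muleA -TA -STA.
Qed.

Lemma scales_coord (j : 'I_d) (a b : R) (w : 'I_d -> R) (T : point -> point) :
  a != 0 ->
  (forall x i, i != j -> T x ord0 i = x ord0 i) ->
  (forall x, T x ord0 j =
    a * x ord0 j + (b + \sum_(i | i != j) w i * x ord0 i)) ->
  scales `|a|^-1 T.
Proof.
move=> a0 Ti Tj A mA.
pose g (t : d.-tuple (measurableTypeR R)) :=
  b + \sum_(i | i != j) w i * tnth t i.
pose S (t : d.-tuple (measurableTypeR R)) := tuple_of_row (T (row_of_tuple t)).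
have [||||mS SA] := @lebesgue_tuple_affine R d j a g S a0.
- apply: measurable_funD => //.
  rewrite [X in measurable_fun _ X](_ : _ = fun t =>
      \sum_(i <- enum 'I_d)
        (fun i t => if i != j then w i * tnth t i else 0) i t).
    apply: measurable_sum => i; case: (i != j) => //.
    apply: (@measurableT_comp _ _ _ _ _ _
      (fun x : measurableTypeR R => w i * x)); first exact: mulrl_measurable.
    exact: measurable_tnth.
  by apply/funext => t; rewrite big_enum big_mkcond.
- move=> t t' tt'; congr (_ + _); apply: eq_bigr => i ij.
  by rewrite tt'.
- by move=> t i ij; rewrite tnth_mktuple Ti// mxE.
- move=> t; rewrite tnth_mktuple Tj mxE; congr (_ + (_ + _)).
  by apply: eq_bigr => i _; rewrite mxE.
have -> : lebesgue_row (T @^-1` A) =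
    lebesgue_tuple R d (S @^-1` (row_of_tuple @^-1` A)).
  congr (lebesgue_tuple R d _); apply/seteqP.
  by split => t /=; rewrite tuple_of_rowK.
split; last exact: SA.
rewrite /row_measurable (_ : _ @^-1` _ = S @^-1` (row_of_tuple @^-1` A)).
  by rewrite -[X in measurable X]setTI; exact: mS.
by apply/seteqP; split => t /=; rewrite tuple_of_rowK.
Qed.

(** Since [w] vanishes in coordinate [i], the multiplier [x ord0 i] stays fixed while the other
    coordinates are moved one after another. *)
Lemma scales_shear (i : 'I_d) (w : point) : w ord0 i = 0 ->
  scales 1 (fun x => x + x ord0 i *: w).
Proof.
move=> wi0.
(* [V m] carries out the shear in the coordinates below [m] only; the induction is on [m]. *)
pose V m (x : point) := x + x ord0 i *: (\row_k (if (k < m)%N then w ord0 k else 0)).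
suff VP m : (m <= d)%N -> scales 1 (V m).
  rewrite (_ : (fun _ => _) = V d); first exact: VP.
  apply/funext => x; congr (_ + _ *: _); apply/rowP => k.
  by rewrite mxE ltn_ord.
elim: m => [_|m IH md].
  rewrite (_ : V 0%N = id); first exact: scales_id.
  by apply/funext => x; apply: row_ext => k; rewrite !mxE ltn0 mulr0 addr0.
pose j := Ordinal md.
pose S (y : point) := y + (w ord0 j * y ord0 i) *: delta_mx ord0 j.
rewrite (_ : V m.+1 = S \o V m); last first.
  apply/funext => x; apply: row_ext => k; rewrite /S/= !mxE eqxx/= ltnS leq_eqVlt.
  rewrite -[(_ == m)]/(k == j).
  have -> : (if (i < m)%N then w ord0 i else 0) = 0 by rewrite wi0 if_same.
  rewrite mulr0 addr0; case: (eqVneq k j) => [->|_] /=.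
    by rewrite ltnn !mulr1 mulr0 addr0 mulrC.
  by rewrite mulr0 addr0.
rewrite -[1](mulr1 1); apply: scales_comp; first by apply: IH; exact: ltnW.
rewrite -[X in scales X]invr1 -(normr1 R).
apply: (@scales_coord j 1 0 (fun k => if k == i then w ord0 j else 0)).
- exact: oner_neq0.
- by move=> x k kj; rewrite !mxE (negbTE kj) andbF mulr0 addr0.
- move=> x; rewrite !mxE !eqxx mulr1 mul1r add0r; congr (_ + _).
  (* If [i = j], the coefficient is [w ord0 i = 0] and this stage is the identity. *)
  have [ij|ij] := eqVneq i j.
    rewrite big1 => [|k kj]; first by rewrite -ij wi0 mul0r.
    by rewrite ij (negbTE kj) mul0r.
  rewrite (bigD1 i)//= eqxx big1 ?addr0// => k /andP[_ /negbTE ->].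
  by rewrite mul0r.
Qed.

(** The scaling is applied to a measurable null set containing [A], as [scales] speaks of measurable
    sets only. *)
Lemma scales_negligible (c : R) (T : point -> point) (A : set point) :
  scales c T -> volume_null A -> volume_null (T @^-1` A).
Proof.
move=> sT [N [mN N0 AN]].
have rN : row_of_tuple @^-1` (tuple_of_row @^-1` N) = N.
  by apply/seteqP; split => t /=; rewrite row_of_tupleK.
have mN' : row_measurable (tuple_of_row @^-1` N) by rewrite /row_measurable rN.
have [mTN TN] := sT _ mN'.
exists (row_of_tuple @^-1` (T @^-1` (tuple_of_row @^-1` N))); split => //.
  by move: TN; rewrite /lebesgue_row rN N0 mule0.
move=> t /= At; apply: AN => /=.
by rewrite -[X in A X]tuple_of_rowK in At.
Qed.

Lemma dotDl (x y z : point) : dot (x + y) z = dot x z + dot y z.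
Proof. by rewrite /dot -big_split; apply: eq_bigr => i _; rewrite mxE mulrDl. Qed.

Lemma dotZl (a : R) (x z : point) : dot (a *: x) z = a * dot x z.
Proof. by rewrite /dot mulr_sumr; apply: eq_bigr => i _; rewrite mxE mulrA. Qed.

Lemma dot_delta (i : 'I_d) (z : point) : dot (delta_mx ord0 i) z = z ord0 i.
Proof.
rewrite /dot (bigD1 i)//= mxE !eqxx mul1r big1 ?addr0// => k ki.
by rewrite mxE (negbTE ki) mul0r.
Qed.

Lemma dot_sumD1 (i : 'I_d) (x z : point) :
  dot x z = x ord0 i * z ord0 i + \sum_(k | k != i) x ord0 k * z ord0 k.
Proof. by rewrite /dot (bigD1 i). Qed.

(** The lines in direction [i] through [E] are cut to a slab of height 1, so that the volume is the
    area of the projection of [E] along that direction. *)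
Definition cylinder (i : 'I_d) (E : set point) : set point :=
  [set y : point | 0 <= y ord0 i <= 1 /\ exists s, E (y + s *: delta_mx ord0 i)].

(** The map [T] sends [y] to [p y + y ord0 i *: nu], where [p y] is the point of the hyperplane on
    the line through [y] in direction [i]. It is a shear [V] fixing coordinate [i], followed by [U],
    which changes only that coordinate, with slope [1 / nu ord0 i]. One [T] serves all subsets [E]
    of the hyperplane. *)
Lemma cylinder_prism (i : 'I_d) (nu : point) (c : R) :
  dot nu nu = 1 -> nu ord0 i != 0 ->
  exists2 T, scales `|nu ord0 i| T &
    forall E, (forall x, E x -> dot x nu = c) ->
      T @^-1` prism E nu = cylinder i E.
Proof.
move=> nu1 nui.
pose w := nu - nu ord0 i *: delta_mx ord0 i.
pose V (x : point) := x + x ord0 i *: w.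
pose U (z : point) := z + ((nu ord0 i)^-1 * z ord0 i + (c / nu ord0 i +
  \sum_(k | k != i) - (nu ord0 k / nu ord0 i) * z ord0 k) - z ord0 i)
   *: delta_mx ord0 i.
pose p (y : point) := y + ((c - dot y nu) / nu ord0 i) *: delta_mx ord0 i.
have UV y : U (V y) = p y + y ord0 i *: nu.
  apply: row_ext => k; rewrite /p /U /V /w !mxE eqxx/= eqxx.
  have [->|ki] := eqVneq k i; last first.
    by rewrite !mulr0 !subr0 !addr0.
  rewrite !mulr1 subrr mulr0 addr0.
  under eq_bigr => j ji do rewrite !mxE (negbTE ji)/= mulr0 subr0 mulrDr.
  rewrite big_split/=.
  rewrite (_ : \sum_(j < d | j != i) - (nu ord0 j / nu ord0 i) * y ord0 j =
     - (\sum_(k | k != i) y ord0 k * nu ord0 k) / nu ord0 i); last first.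
    by rewrite mulNr mulr_suml -sumrN; apply: eq_bigr => j _; field.
  rewrite (_ : \sum_(j < d | j != i) - (nu ord0 j / nu ord0 i) *
      (y ord0 i * nu ord0 j) =
     - (y ord0 i * \sum_(k | k != i) nu ord0 k * nu ord0 k) / nu ord0 i);
     last first.
    rewrite mulNr mulr_sumr mulr_suml -sumrN.
    by apply: eq_bigr => j _; field.
  rewrite (dot_sumD1 i y).
  have -> : \sum_(k | k != i) nu ord0 k * nu ord0 k = 1 - nu ord0 i ^+ 2.
    by rewrite -nu1 (dot_sumD1 i) expr2 addrC addKr.
  by field.
have dotp y : dot (p y) nu = c.
  by rewrite dotDl dotZl dot_delta divfK// addrC subrK.
exists (U \o V).
  rewrite -[`|_|]mul1r; apply: scales_comp.
    by apply: scales_shear; rewrite !mxE !eqxx mulr1 subrr.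
  rewrite -[`|_|]invrK -normfV.
  apply: (@scales_coord i _ (c / nu ord0 i)
    (fun k => - (nu ord0 k / nu ord0 i))); first by rewrite invr_neq0.
    by move=> x k ki; rewrite !mxE (negbTE ki) andbF mulr0 addr0.
  by move=> x; rewrite !mxE !eqxx mulr1 addrC subrK.
move=> E Ec; apply/seteqP; split => y /=.
  rewrite UV => -[x Ex] [t]; rewrite /= in_itv/= => t01 xt.
  have ty : t = y ord0 i.
    (* Both [x] and [p y] lie in the hyperplane and [nu] is a unit vector, so the product with [nu]
       reads off the height in the prism. *)
    have := congr1 (dot ^~ nu) xt.
    rewrite /= [LHS]dotDl [RHS]dotDl dotp (Ec _ Ex) !dotZl nu1 !mulr1.
    exact: addrI.
  split; first by rewrite -ty.
  exists ((c - dot y nu) / nu ord0 i).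
  by move: xt; rewrite ty -/(p y) => /addIr <-.
move=> [y01 [s Es]]; rewrite UV.
exists (y + s *: delta_mx ord0 i) => //; exists (y ord0 i) => //.
congr (_ + _); congr (_ + _ *: _).
have := Ec _ Es; rewrite dotDl dotZl dot_delta => <-.
by rewrite addrC addKr mulfK.
Qed.

(** Replacing coordinate [j] by [dot x nu - c] makes the hyperplane the preimage of a coordinate
    hyperplane. *)
Lemma hyperplane_null (nu : point) (c : R) (j : 'I_d) : nu ord0 j != 0 ->
  volume_null [set x | dot x nu = c].
Proof.
move=> nuj.
pose T (x : point) := x + (nu ord0 j * x ord0 j + (- c +
  \sum_(k | k != j) nu ord0 k * x ord0 k) - x ord0 j) *: delta_mx ord0 j.
have sT : scales `|nu ord0 j|^-1 T.
  apply: (@scales_coord j _ (- c) (fun k => nu ord0 k)) => //.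
    by move=> x k kj; rewrite !mxE (negbTE kj) andbF mulr0 addr0.
  by move=> x; rewrite !mxE !eqxx mulr1 addrC subrK.
have rj : row_of_tuple @^-1` [set x : point | x ord0 j = 0] =
    [set t | tnth t j = 0].
  by apply/seteqP; split => t /=; rewrite mxE.
rewrite [X in volume_null X](_ : _ = T @^-1` [set x | x ord0 j = 0]).
  apply: scales_negligible sT _; rewrite /volume_null rj.
  apply/negligibleP; last exact: lebesgue_tuple_coord0.
  rewrite -[X in measurable X]setTI.
  exact: (@measurable_tnth _ (measurableTypeR R) d j measurableT [set 0]
    (measurable_set1 _)).
apply/seteqP; split => x /=; rewrite !mxE !eqxx mulr1 addrC subrK (dot_sumD1 j);
  rewrite (mulrC (x ord0 j));
  under eq_bigr do rewrite mulrC; lra.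
Qed.

End LebesgueRow.

(** * Measurability and measure of open and compact sets *)

Section RowTopology.
Context {R : realType} {d : nat}.
Local Notation point := 'rV[R]_d.
Implicit Types (A U : set point) (x y : point).

Definition box (c : point) (r : R) : set point :=
  [set y | forall i, `|c ord0 i - y ord0 i| < r].

Lemma box_measurable c r : 0 < r -> row_measurable (box c r).
Proof.
move=> r0; have [+ _] := @lebesgue_tuple_box R d (c ord0) r r0.
congr (measurable _); apply/seteqP.
by split => t + i => /(_ i); rewrite mxE.
Qed.

Lemma lebesgue_row_box c r : 0 < r -> lebesgue_row (box c r) = ((r *+ 2) ^+ d)%:E.
Proof.
move=> r0; have [_ <-] := @lebesgue_tuple_box R d (c ord0) r r0.
congr (lebesgue_tuple R d _); apply/seteqP.
by split => t + i => /(_ i); rewrite mxE.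
Qed.

Lemma box_ball c r : 0 < r -> box c r `<=` ball c r.
Proof. by move=> r0 y cy; split=> // i j; rewrite ord1; exact: cy. Qed.

(** An open set is the countable union of the boxes with rational centre and radius that it
    contains. *)
Lemma open_row_measurable U : open U -> row_measurable U.
Proof.
move=> oU.
pose F (q : 'rV[rat]_d * rat) : set (d.-tuple (measurableTypeR R)) :=
  let B := box (map_mx ratr q.1) (ratr q.2) in
  if `[< 0 < q.2 /\ B `<=` U >] then row_of_tuple @^-1` B else set0.
rewrite /row_measurable (_ : _ @^-1` _ = \bigcup_q F q); last first.
  apply/seteqP; split => t; last first.
    by move=> [q _]; rewrite /F; case: asboolP => // -[_ BU] /BU.
  move=> /= Ut; set x := row_of_tuple t in Ut.
  have /nbhs_ballP[e /= e0 eU] : nbhs x U by exact: open_nbhs_nbhs.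
  (* A centre within [r < e / 2] of [x] gives a box that contains [x] and stays within distance [e]
     of it. *)
  have [r] := @rat_in_itvoo R 0 (e / 2) (divr_gt0 e0 (ltr0Sn _ _)).
  rewrite in_itv/= => /andP[r0 re].
  have /choice[q qP] : forall i, exists q : rat, `|ratr q - x ord0 i| < ratr r.
    move=> i; have [|q] := @rat_in_itvoo R (x ord0 i - ratr r) (x ord0 i + ratr r).
      by lra.
    by rewrite in_itv/= => xq; exists q; rewrite ltr_distl.
  exists (\row_i q i, r) => //; rewrite /F asboolT/=.
    by move=> i; rewrite !mxE; have := qP i; rewrite mxE.
  split; first by rewrite ltr0q in r0.
  move=> y qy; apply: eU; apply: (@box_ball _ e) => // i.
  have h2 := qP i; have h1 := qy i; rewrite !mxE in h1.
  rewrite (le_lt_trans (ler_distD (ratr (q i)) _ _))//.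
  by rewrite (splitr e) ltrD// ?(lt_trans h1)// distrC (lt_trans h2).
apply: countable_bigcupT_measurable => // -[q r]; rewrite /F.
case: asboolP => //= -[r0 _]; apply: box_measurable.
by rewrite ltr0q.
Qed.

Lemma closed_row_measurable A : closed A -> row_measurable A.
Proof.
rewrite -openC => /open_row_measurable mA; rewrite /row_measurable.
by rewrite -[X in measurable X]setCK preimage_setC; exact: measurableC.
Qed.

Lemma compact_row_measurable A : compact A -> row_measurable A.
Proof.
move=> cA; apply: closed_row_measurable.
by apply: compact_closed => //; exact: norm_hausdorff.
Qed.

Lemma compact_coord_bounded A : compact A ->
  exists2 r, 0 < r & forall x, A x -> forall i, `|x ord0 i| < r.
Proof.
move=> /compact_bounded[r [_ rA]]; exists (`|r| + 2).
  by rewrite ltr_wpDl.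
move=> x Ax i; have /(_ _)/(_ x Ax) := rA (`|r| + 1).
rewrite (le_lt_trans (ler_norm r)) ?ltrDl// => /(_ isT) xr.
rewrite (@le_lt_trans _ _ (`|r| + 1))// ?ltrD2l ?ltr1n//.
apply: le_trans xr; rewrite [leRHS]/Num.Def.normr/= mx_normrE.
exact: (le_bigmax _ _ (ord0, i)).
Qed.

Lemma lebesgue_row_compact_lty A : compact A -> (lebesgue_row A < +oo)%E.
Proof.
move=> cA; have [r r0 rA] := compact_coord_bounded cA.
apply: (@le_lt_trans _ _ (lebesgue_row (box 0 r))).
  apply: le_measure; rewrite ?inE.
  - exact: compact_row_measurable.
  - exact: box_measurable.
  - by move=> t /rA h i /=; rewrite mxE sub0r normrN; exact: h.
by rewrite lebesgue_row_box// ltry.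
Qed.

Lemma lebesgue_row_gt0 A : row_measurable A -> interior A !=set0 ->
  (0 < lebesgue_row A)%E.
Proof.
move=> mA [x /nbhs_ballP[e /= e0 eA]].
apply: (@lt_le_trans _ _ (lebesgue_row (box x e))).
  by rewrite lebesgue_row_box// lte_fin exprn_gt0// pmulrn_lgt0.
apply: le_measure; rewrite ?inE//; first exact: box_measurable.
by move=> t xt; apply: eA; apply: box_ball.
Qed.

Lemma volume_cell_gt0 (K : cell R d) : 0 < volume K.
Proof.
have mK : row_measurable K by apply: compact_row_measurable; exact: cell_compact.
apply: fine_gt0; apply/andP; split.
  exact/lebesgue_row_gt0/cell_nonempty.
exact/lebesgue_row_compact_lty/cell_compact.
Qed.

Lemma edge_sub (K : cell R d) l : edge (c := K) l `<=` K.
Proof.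
move=> x Kx; have : (\bigcup_l edge (c := K) l) x by exists l.
by rewrite -cell_boundary => -[].
Qed.

Lemma compact_prism (E : set point) (nu : point) : compact E -> compact (prism E nu).
Proof.
move=> cE.
rewrite (_ : prism E nu = (fun z : point * R => z.1 + z.2 *: nu) @` (E `*` `[0, 1])).
  apply: continuous_compact; last first.
    by apply: compact_setX => //; exact: segment_compact.
  apply: continuous_subspaceT => z.
  apply: cvgD; first exact: cvg_fst.
  by apply: cvgZr_tmp; exact: cvg_snd.
apply/seteqP; split => [_ [x Ex [t t01 <-]]|_ [[x t] [/= Ex t01] <-]].
  by exists (x, t).
by exists x => //; exists t.
Qed.

Lemma compact_edge (K : cell R d) l : compact (edge (c := K) l).
Proof.
by apply: subclosed_compact (@edge_sub K l); [exact: edge_closed|exact: cell_compact].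
Qed.

End RowTopology.

(** * Crossings of a cell boundary by a line *)

(** A locally constant function has zero derivative everywhere. *)
Lemma locally_constant_const (R : realType) (h : R -> R) :
  (forall s, \forall s' \near s, h s' = h s) -> forall x y, h x = h y.
Proof.
move=> hs x y; apply: is_derive_0_is_cst => s.
apply: (@near_eq_is_derive R R R (cst (h s))).
by apply: filterS (hs s) => s' ->.
Qed.

Section Crossings.
Context {R : realType} {d : nat}.
Local Notation point := 'rV[R]_d.
Variables (K : cell R d) (i : 'I_d) (y : point).
Let p (s : R) : point := y + s *: delta_mx ord0 i.
Let nu (l : 'I_(nedges K)) : R := normal l ord0 i.

Hypothesis transversal : forall l s, edge l (p s) -> nu l != 0.
Hypothesis outer : forall l s, edge (c := K) l (p s) ->
  outer_normal_at K (normal (c := K) l) (p s).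
Hypothesis simple : forall l l' s, edge (c := K) l (p s) -> edge l' (p s) -> l = l'.

Let p_cvg s : p s' @[s' --> s] --> p s.
Proof.
apply: cvgD; first exact: cvg_cst.
by apply: cvgZr_tmp; exact: cvg_id.
Qed.

(** Along the line, the product with the edge normal is affine with nonzero slope, while it is
    constant on the edge. *)
Let edge_once (l : 'I_(nedges K)) s s' : edge l (p s) -> edge l (p s') -> s = s'.
Proof.
move=> es es'; have [c cE] := edge_flat l.
have := cE _ es; rewrite -(cE _ es') !dotDl !dotZl !dot_delta => /addrI.
exact/mulIf/(transversal es).
Qed.

(* With [<] at exits and [<=] at entries, [jump] compensates the indicator of
   the closed set [K] exactly at crossings, so that [height] is locally constant. *)
Let jump (l : 'I_(nedges K)) s :=
  if 0 < nu l then `[< exists2 t, edge l (p t) & t < s >]%:R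
  else - `[< exists2 t, edge l (p t) & t <= s >]%:R : R.

Let jumpE (l : 'I_(nedges K)) t u : edge l (p t) ->
  jump l u = if 0 < nu l then (t < u)%R%:R else - (t <= u)%R%:R.
Proof.
move=> et; rewrite /jump; case: ifPn => _; congr (_ _ _).
  congr nat_of_bool; apply/asboolP/idP => [[t' et']|tu]; last by exists t.
  by rewrite (edge_once et et').
congr (_ _ _); congr nat_of_bool; apply/asboolP/idP => [[t' et']|tu].
  by rewrite (edge_once et et').
by exists t.
Qed.

Let jump_near (l : 'I_(nedges K)) s : ~ edge l (p s) ->
  \forall s' \near s, jump l s' = jump l s.
Proof.
move=> els; have [[t et]|nt] := pselect (exists t, edge l (p t)); last first.
  apply: (@nearW _ (nbhs s)) => s'; rewrite /jump.
  by case: ifPn => _; congr (_ _ _); rewrite !asboolF// => -[t et]; case: nt; exists t.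
have ts : t != s by apply: contra_notN els => /eqP <-.
have jE u := jumpE u et.
have [lt_ts|lt_st|/eqP] := ltgtP t s; last by rewrite (negbTE ts).
- have : \forall s' \near s, t < s' by exact: lt_nbhsr.
  by apply: filterS => s' ts'; rewrite !jE ts' lt_ts (ltW ts') (ltW lt_ts).
- have : \forall s' \near s, s' < t by exact: lt_nbhsl.
  apply: filterS => s' ts'.
  by rewrite !jE (lt_gtF ts') (lt_gtF lt_st) (lt_geF ts') (lt_geF lt_st).
Qed.

Let height s := `[< (K : set _) (p s) >]%:R + \sum_l jump l s.

(** Off the edges each term is locally constant. At an edge point only one edge is involved, and [K]
    is a half-space nearby, so the changes of the indicator and of one jump cancel. *)
Let height_near s : \forall s' \near s, height s' = height s.
Proof.
have [[l el]|nol] := pselect (exists l : 'I_(nedges K), edge l (p s)); last first.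
  have jn : \forall s' \near s, forall l, jump l s' = jump l s.
    by apply: (@filter_forall _ _ _ (nbhs s)) => l; apply: jump_near => el;
      apply: nol; exists l.
  have Kn : \forall s' \near s, `[< (K : set _) (p s') >] = `[< (K : set _) (p s) >].
    have [Ks|nKs] := pselect ((K : set _) (p s)).
      (* A point of [K] on no edge is interior, since the edges cover the boundary. *)
      have : interior K (p s).
        apply: contrapT => nint.
        have : (cell_set K `\` interior K) (p s) by [].
        by rewrite cell_boundary => -[l _ el]; apply: nol; exists l.
      move=> /p_cvg; rewrite /= nbhs_simpl /=.
      by apply: filterS => s' Ks'; rewrite !asboolT.
    have : nbhs (p s) (~` (K : set _)).
      apply: open_nbhs_nbhs; split=> //; rewrite openC.
      by rewrite cell_regular; exact: closed_closure.
    move=> /p_cvg; rewrite /= nbhs_simpl /=.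
    by apply: filterS => s' Ks'; rewrite !asboolF.
  near=> s'; rewrite /height; congr (_ + _).
    by congr (nat_of_bool _)%:R; near: s'.
  by apply: eq_bigr => l _; move: l; near: s'.
have jn : \forall s' \near s, forall l', l' != l -> jump l' s' = jump l' s.
  apply: (@filter_forall _ _ _ (nbhs s)) => l'; have [->|ll'] := eqVneq l' l.
    by apply: (@nearW _ (nbhs s)).
  apply: filterS (_ : \forall s' \near s, jump l' s' = jump l' s) => // .
  by apply: jump_near => el'; rewrite (simple el el') eqxx in ll'.
have Kn : \forall s' \near s, (K : set _) (p s') <-> (s' - s) * nu l <= 0.
  have := outer el; rewrite /outer_normal_at => /p_cvg; rewrite /= nbhs_simpl /=.
  apply: filterS => s'.
  by rewrite /p/= opprD addrACA subrr add0r -scalerBl dotZl dot_delta.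
near=> s'; rewrite /height [in LHS](bigD1 l)//= [in RHS](bigD1 l)//= !addrA.
congr (_ + _); last first.
  by apply: eq_bigr => l' ll'; move: l' ll'; near: s'.
have -> : `[< (K : set _) (p s') >] = ((s' - s) * nu l <= 0).
  by apply/asboolP/idP => /(near Kn s') h; apply h.
have -> : `[< (K : set _) (p s) >] = true by apply/asboolP; exact: edge_sub el.
(* At an exit ([nu l > 0]) indicator plus jump is 1 on both sides and at [s]; at an entry it is
   0. *)
rewrite !(jumpE _ el) ltxx lexx; have [nu0|nu0|/eqP] := ltgtP 0 (nu l).
- by rewrite pmulr_lle0// subr_le0 addr0; case: ltP => _; rewrite ?add0r ?addr0.
- by rewrite nmulr_lle0// subr_ge0; case: (s <= s'); rewrite ?subr0 ?subrr.
- by rewrite eq_sym (negbTE (transversal el)).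
Unshelve. all: by end_near. Qed.

(** The constant [height] is compared before and after the line passes through [K]: first all jumps
    are zero, at the end they add up to the signed count. *)
Lemma signed_crossings :
  \sum_l Num.sg (normal (c := K) l ord0 i) *
    `[< exists s, edge l (y + s *: delta_mx ord0 i) >]%:R = 0 :> R.
Proof.
have [r r0 rK] := compact_coord_bounded (@cell_compact _ _ K).
(* At these parameters coordinate [i] equals [- r] and [r], just beyond all points of [K]. *)
pose sm := - r - y ord0 i; pose sp := r - y ord0 i.
have pi s : p s ord0 i = y ord0 i + s by rewrite !mxE !eqxx mulr1.
have hitlt (l : 'I_(nedges K)) t : edge l (p t) -> sm < t < sp.
  move=> /edge_sub /rK /(_ i); rewrite pi ltr_norml /sm /sp; lra.
have Kout s : (s <= sm) || (sp <= s) -> `[< (K : set _) (p s) >] = false.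
  move=> smp; apply/asboolP => /rK /(_ i); rewrite pi ltr_norml.
  by move: smp; rewrite /sm /sp; lra.
have := locally_constant_const height_near sp sm.
rewrite /height !Kout ?lexx ?orbT// !add0r.
rewrite [RHS]big1 => [|l _]; last first.
  rewrite /jump; case: ifPn => _.
    by rewrite asboolF// => -[t /hitlt /andP[/lt_gtF ->]].
  by rewrite asboolF ?oppr0// => -[t /hitlt /andP[mt _]]; rewrite leNgt mt.
move=> sum0; rewrite -[RHS]sum0; apply: eq_bigr => l _; rewrite /jump.
have [[t et]|nt] := pselect (exists t, edge l (p t)); last first.
  rewrite [in LHS]asboolF// mulr0; case: ifPn => _.
    by rewrite asboolF// => -[t et]; case: nt; exists t.
  by rewrite asboolF ?oppr0// => -[t et]; case: nt; exists t.
rewrite [in LHS]asboolT; last by exists t.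
have /andP[_ tsp] := hitlt _ _ et.
case: ifPn => nul.
  by rewrite asboolT ?gtr0_sg ?mulr1//; exists t.
rewrite asboolT; last by exists t => //; exact: ltW.
by rewrite ltr0_sg ?mulr1// lt_neqAle (transversal et) leNgt.
Qed.

End Crossings.

(** * The divergence theorem for constant fields *)

Section ClosedSurface.
Context {R : realType} {d : nat}.
Local Notation point := 'rV[R]_d.
Variables (K : cell R d) (i : 'I_d).
Implicit Types (l : 'I_(nedges K)) (t : d.-tuple (measurableTypeR R)).
Let mu := lebesgue_tuple R d.
Let nu l : R := normal l ord0 i.
Let Z l : set (d.-tuple (measurableTypeR R)) := row_of_tuple @^-1` cylinder i (edge l).

Lemma edge_size_ge0 l : 0 <= edge_size l.
Proof. exact: fine_ge0. Qed.

Lemma edge_size_fin l : (edge_size l)%:E = lebesgue_row (prism (edge l) (normal l)).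
Proof.
rewrite fineK// ge0_fin_numE//.
by apply: lebesgue_row_compact_lty; apply: compact_prism; exact: compact_edge.
Qed.

Let prism_measurable l : row_measurable (prism (edge l) (normal l)).
Proof. by apply: compact_row_measurable; apply: compact_prism; exact: compact_edge. Qed.

Let cylinder_null l (E : set point) : nu l != 0 -> E `<=` edge l ->
  surface_null E (normal l) -> volume_null (cylinder i E).
Proof.
move=> nul El nE; have [c cE] := edge_flat l.
have [T sT TE] := cylinder_prism c (normal_unit l) nul.
rewrite -TE; first exact: scales_negligible sT nE.
by move=> x /El; exact: cE.
Qed.

Let Z_measurable l : nu l != 0 -> measurable (Z l).
Proof.
move=> nul; have [c cE] := edge_flat l.
have [T sT TE] := cylinder_prism c (normal_unit l) nul.
rewrite /Z -TE//; apply: (sT _ _).1.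
exact: prism_measurable.
Qed.

Let Z_measure l : nu l != 0 -> mu (Z l) = (`|nu l| * edge_size l)%:E.
Proof.
move=> nul; have [c cE] := edge_flat l.
have [T sT TE] := cylinder_prism c (normal_unit l) nul.
rewrite EFinM edge_size_fin -(sT _ _).2.
  by rewrite TE.
exact: prism_measurable.
Qed.

(** These are the three hypotheses on crossings, asked only in the slab, where the cylinders control
    the exceptional points. *)
Let good l (y : point) := 0 <= y ord0 i <= 1 -> forall s,
  edge l (y + s *: delta_mx ord0 i) ->
  [/\ nu l != 0,
      outer_normal_at K (normal l) (y + s *: delta_mx ord0 i) &
      forall l', l' != l -> ~ edge l' (y + s *: delta_mx ord0 i)].

(** For [nu l != 0] the exceptional points lie in cylinders over null parts of the edge, and these
    are null by comparison with prisms. *)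
Let good_ae : \forall t \ae mu, forall l, good l (row_of_tuple t).
Proof.
apply: filter_forall => l; have [nul0|nul] := eqVneq (nu l) 0.
  have [c cE] := edge_flat l.
  have [j nuj] : exists j, normal l ord0 j != 0.
    apply: contrapT => nuj; have := normal_unit l.
    rewrite /dot big1 => [/eqP|j _]; first by rewrite eq_sym oner_eq0.
    have [->|nj] := eqVneq (normal l ord0 j) 0; first by rewrite mulr0.
    by case: nuj; exists j.
  (* A line parallel to the hyperplane of the edge and meeting the edge lies in that hyperplane, so
     its points form a null set. *)
  apply: negligibleS (hyperplane_null c nuj) => t /=.
  apply: contra_notP => tc _ s /cE; rewrite dotDl dotZl dot_delta.
  by rewrite -/(nu l) nul0 mulr0 addr0.
have outer_ae : \forall t \ae mu, ~ cylinder i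
    (edge l `\` outer_normal_at K (normal l)) (row_of_tuple t).
  have := cylinder_null nul (@subDsetl _ _ _) (edge_outer l).
  by apply: negligibleS => t /= /contrapT.
have overlap_ae : \forall t \ae mu, forall l', l' != l ->
    ~ cylinder i (edge l `&` edge l') (row_of_tuple t).
  apply: filter_forall => l'; have [->|ll'] := eqVneq l' l; first exact: aeW.
  have := cylinder_null nul (@subIsetl _ _ _) (edge_overlap _).
  move=> /(_ l'); rewrite eq_sym => /(_ ll').
  by apply: negligibleS => t /= nt; apply: contrapT => h; apply: nt.
apply: filterS2 outer_ae overlap_ae => t out over y01 s el; split=> //.
  by apply: contrapT => nout; apply: out; split=> //; exists s.
by move=> l' ll' el'; apply: (over _ ll'); split=> //; exists s.
Qed.

(** Exits and entries are kept on separate sides so that both sides are nonnegative and can be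
    integrated without subtraction. *)
Let crossing_ae :
  \forall t \ae mu, \sum_l (if 0 < nu l then \1_(Z l) t else 0) =
    \sum_l (if nu l < 0 then \1_(Z l) t else 0) :> R.
Proof.
apply: filterS good_ae => t tgood; apply/eqP; rewrite -subr_eq0 -sumrB; apply/eqP.
have [y01|ny01] := boolP (0 <= row_of_tuple t ord0 i <= 1); last first.
  apply: big1 => l _; rewrite indicE memNset.
    by rewrite !if_same subrr.
  by move=> /= -[y01 _]; rewrite y01 in ny01.
rewrite -[RHS](@signed_crossings R d K i (row_of_tuple t)).
- apply: eq_bigr => l _; rewrite indicE -/(nu l).
  have -> : (t \in Z l) = `[< exists s, edge l (row_of_tuple t + s *: delta_mx ord0 i) >].
    by apply/idP/asboolP => [/set_mem[]//|h]; apply/mem_set; split.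
  have [nul|nul|<-] := ltgtP 0 (nu l).
  + by rewrite subr0 gtr0_sg ?mul1r.
  + by rewrite sub0r ltr0_sg ?mulN1r.
  + by rewrite sgr0 mul0r subrr.
- by move=> l s /(tgood l y01)[].
- by move=> l s /(tgood l y01)[].
- move=> l l' s /(tgood l y01)[_ _ ll'] el'; apply: contrapT => /eqP.
  by rewrite eq_sym => /ll' /(_ el').
Qed.

Lemma closed_surface :
  \sum_(l < nedges K) edge_size l * normal l ord0 i = 0.
Proof.
(* The selector [b] picks edges by the sign of [nu l]; edges with [nu l = 0], whose cylinders are
   not shown measurable, are never picked. *)
pose F (b : 'I_(nedges K) -> bool) l t : \bar R := if b l then (\1_(Z l) t)%:E else 0%E.
have mF (b : 'I_(nedges K) -> bool) l : (b l -> nu l != 0) -> measurable_fun setT (F b l).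
  rewrite /F; case: (b l) => // /(_ isT) nul.
  by apply/measurable_EFinP; apply: measurable_indic; exact: Z_measurable.
have intF (b : 'I_(nedges K) -> bool) : (forall l, b l -> nu l != 0) ->
    (\int[mu]_t \sum_l F b l t =
     (\sum_l (if b l then `|nu l| * edge_size l else 0))%:E)%E.
  move=> bnu; rewrite -sumEFin ge0_integral_sum//.
  - apply: eq_bigr => l _; rewrite /F; case: ifPn => bl; last by rewrite integral0.
    rewrite integral_indic//; last by apply: Z_measurable; exact: bnu.
    by rewrite setIT; apply: Z_measure; exact: bnu.
  - by move=> l; apply: mF; exact: bnu.
  - by move=> l t _; rewrite /F; case: ifP => // _; rewrite lee_fin.
have pos l : 0 < nu l -> nu l != 0 by move/lt0r_neq0.
have neg l : nu l < 0 -> nu l != 0 by move/ltr0_neq0.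
have : (\int[mu]_t \sum_l F (fun l => 0 < nu l)%R l t =
        \int[mu]_t \sum_l F (fun l => nu l < 0)%R l t)%E.
  apply: ge0_ae_eq_integral => //.
  - by apply: emeasurable_sum => l; apply: mF; exact: pos.
  - by apply: emeasurable_sum => l; apply: mF; exact: neg.
  - by move=> t _; apply: sume_ge0 => l _; rewrite /F; case: ifP => // _; rewrite lee_fin.
  - by move=> t _; apply: sume_ge0 => l _; rewrite /F; case: ifP => // _; rewrite lee_fin.
  apply: filterS crossing_ae => t tE _.
  have FE (b : 'I_(nedges K) -> bool) : \sum_l F b l t =
      (\sum_l (if b l then \1_(Z l) t else 0))%:E.
    by rewrite -sumEFin; apply: eq_bigr => l _; rewrite /F; case: ifP.
  by rewrite !FE tE.
rewrite !intF// => -[] /eqP; rewrite -subr_eq0 -sumrB => /eqP sum0.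
rewrite -[RHS]sum0; apply: eq_bigr => l _; rewrite -/(nu l) mulrC.
have [nul|nul|<-] := ltgtP 0 (nu l).
- by rewrite subr0 gtr0_norm.
- by rewrite sub0r ltr0_norm// mulNr opprK.
- by rewrite mul0r subrr.
Qed.

End ClosedSurface.

(** * The averaged scheme *)

Section Polynomials.
Context {R : realType} {d : nat}.
Local Notation point := 'rV[R]_d.
Implicit Types (Z : degree_kind) (p q : point -> R).

Lemma polynomials_cst Z k (a : R) : polynomials (d := d) Z k (cst a).
Proof.
exists (fun e => if e == [ffun=> ord0] then a else 0); split=> [e _ ke|x].
  case: eqVneq => // e0; move: ke.
  by rewrite e0 big1 ?ltn0// => i _; rewrite ffunE.
rewrite (bigD1 [ffun=> ord0])//= eqxx big1 ?mulr1 => [|i _].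
  by rewrite big1 ?addr0// => e /negbTE ->; rewrite mul0r.
by rewrite ffunE expr0.
Qed.

Lemma polynomials_lin Z k (a b : R) p q :
  polynomials Z k p -> polynomials Z k q ->
  polynomials Z k (fun x => a * p x + b * q x).
Proof.
move=> [cp [cp0 pE]] [cq [cq0 qE]]; exists (fun e => a * cp e + b * cq e); split.
  by move=> e Zk ke; rewrite cp0// cq0// !mulr0 addr0.
move=> x; rewrite pE qE !mulr_sumr -big_split; apply: eq_bigr => e _ /=.
by rewrite !mulrA -mulrDl.
Qed.

Lemma polynomials_continuous Z k p : polynomials Z k p -> continuous p.
Proof.
move=> [c [_ pE]].
have -> : p = fun x => \sum_e c e * \prod_j x ord0 j ^+ e j by exact/funext.
apply: continuous_big => [|e _]; first exact: add_continuous.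
have pc : continuous (fun x : point => \prod_j x ord0 j ^+ e j).
  apply: continuous_big => [|j _ x]; first exact: mul_continuous.
  apply: (@continuous_comp _ _ _ (fun x : point => x ord0 j) (fun r => r ^+ e j)).
    exact: coord_continuous.
  exact: exprn_continuous.
by move=> x; exact: cvgM (cvg_cst _) (pc x).
Qed.

End Polynomials.

Section Dot.
Context {R : realType} {d : nat}.
Local Notation point := 'rV[R]_d.

Lemma dot_continuous (z : point) : continuous (dot ^~ z).
Proof.
apply: continuous_big => [|i _ x]; first exact: add_continuous.
exact: cvgM (@coord_continuous R 1 d ord0 i x) (cvg_cst _).
Qed.

Lemma dot0r (x : point) : dot x 0 = 0.
Proof. by rewrite /dot big1// => i _; rewrite mxE mulr0. Qed.

Lemma is_derive_dot (f : R -> point) (z : point) (w : R) :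
  derivable f w 1 -> is_derive w 1 (fun t => dot (f t) z) (dot (derive1 f w) z).
Proof.
move=> df; have dfi := (derivable_mxP _ _ _).1 df.
have -> : (fun t => dot (f t) z) = \sum_(i < d) (z ord0 i \*: (fun t => f t ord0 i)).
  by apply/funext => t; rewrite fct_sumE; apply: eq_bigr => i _; rewrite mulrC.
have -> : dot (derive1 f w) z = \sum_(i < d) z ord0 i *: 'D_1 (fun t => f t ord0 i) w.
  by apply: eq_bigr => i _; rewrite derive1E derive_mx// mxE mulrC.
apply: is_derive_sum => i; apply: is_deriveZ.
exact/derivableP/dfi.
Qed.

End Dot.

(** The closure of a connected set is connected, so intermediate values are attained on it. A cell
    is the closure of its connected interior. *)
Lemma continuous_closure_itv (R : realType) (X : topologicalType) (A : set X)
    (u : X -> R) (x y : X) (c : R) :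
  connected A -> continuous u -> closure A x -> closure A y ->
  u x <= c <= u y -> exists2 z, closure A z & u z = c.
Proof.
move=> cA uc Ax Ay xcy.
have /connected_intervalP iu : connected (u @` closure A).
  apply: connected_continuous_connected; first exact: connected_closure.
  exact: continuous_subspaceT.
by have [z] := iu (u x) (u y) (imageP _ Ax) (imageP _ Ay) c xcy; exists z.
Qed.

(** It supplies the boundedness without which [sup] and [inf] need not bound the elements of a
    set. *)
Lemma finite_ubound (R : realType) (I : finType) (F : I -> R) :
  exists M, forall i, `|F i| <= M.
Proof.
exists (\sum_i `|F i|) => i; rewrite (bigD1 i)//= lerDl.
by apply: sumr_ge0 => j _.
Qed.

(* Each term splits as [w (z - c)] plus a flux defect that it dominates; the
   constant parts [F0] cancel since [sum mu F0 = 0]. *)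
Lemma perturbed_average_ge (R : realType) (na ne : nat) (nb : 'I_ne -> nat)
    (wi v : 'I_na -> R) (w wB z F : forall l, 'I_(nb l) -> R)
    (F0 mu : 'I_ne -> R) (c : R) :
  (forall a, 0 <= wi a) ->
  \sum_a wi a + \sum_l \sum_(b < nb l) w l b = 1 ->
  (forall l, \sum_(b < nb l) wB l b = 1) -> \sum_l mu l * F0 l = 0 ->
  (forall a, c <= v a) ->
  (forall l b, `|mu l * wB l b * (F l b - F0 l)| <= w l b * (z l b - c)) ->
  c <= \sum_a wi a * v a + \sum_l \sum_(b < nb l) w l b * z l b +
       \sum_l mu l * \sum_(b < nb l) wB l b * F l b.
Proof.
move=> wi0 w1 wB1 muF0 cv bound.
(* Writing [c] as its own convex combination plus the vanishing sum of the [F0] terms allows a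
   comparison term by term. *)
rewrite [leLHS](_ : _ = \sum_a wi a * c +
    \sum_l (\sum_(b < nb l) w l b * c + mu l * F0 l)); last first.
  rewrite big_split/= muF0 addr0 -[LHS]mul1r -w1 mulrDl !mulr_suml.
  by congr (_ + _); apply: eq_bigr => l _; rewrite mulr_suml.
rewrite -addrA lerD//; first by apply: ler_sum => a _; exact: ler_wpM2l.
rewrite -big_split; apply: ler_sum => l _ /=.
rewrite -[F0 l]mulr1 -(wB1 l) !mulr_sumr -!big_split/=.
apply: ler_sum => b _; have := bound l b; rewrite ler_norml => /andP[+ _]; lra.
Qed.

(** * Bounds by the mesh constants and averages of the scheme *)

Section Scheme.
Context {R : realType} {d : nat} {Omega : set 'rV[R]_d}.
Variables (T : mesh Omega) (k : nat) (Z : 'I_(ncells T) -> degree_kind).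
Variable Q : quadrature k Z.
Local Notation point := 'rV[R]_d.
Implicit Types (K : 'I_(ncells T)) (u D : dg_function T) (f : R -> point).

Lemma mesh_ratio_ge dt K (l : 'I_(nedges (T K))) :
  dt * edge_size l / volume (T K) <= mesh_ratio T dt.
Proof.
apply: ub_le_sup; last by exists K, l.
pose F (i : {K : 'I_(ncells T) & 'I_(nedges (T K))}) :=
  dt * edge_size (tagged i) / volume (T (tag i)).
have [M FM] := finite_ubound F.
exists M => _ [K' [l' ->]]; apply: le_trans (FM (Tagged _ l')).
exact: ler_norm.
Qed.

Lemma decomposition_constant_le K (l : 'I_(nedges (T K))) (b : 'I_(edge_npts Q l)) :
  decomposition_constant Q <= wI_edge b / wB b.
Proof.
apply: ge_inf; last by exists K, l, b.
pose F (i : {j : {K : 'I_(ncells T) & 'I_(nedges (T K))} &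
    'I_(edge_npts Q (tagged j))}) := wI_edge (tagged i) / wB (tagged i).
have [M FM] := finite_ubound F.
exists (- M) => _ [K' [l' [b' ->]]].
have := FM (@Tagged _ (Tagged _ l')
  (fun j : {K : 'I_(ncells T) & 'I_(nedges (T K))} => 'I_(edge_npts Q (tagged j))) b').
by rewrite ler_norml => /andP[].
Qed.

Lemma cell_neq0 (C : cell R d) : (C : set point) !=set0.
Proof. by have [x] := cell_nonempty C; exists x; exact: interior_subset. Qed.

(** The set of speeds is bounded: on each compact cell the continuous speed attains a maximum, and
    there are finitely many cells and edges. *)
Lemma max_wave_speed_ge f u K' x K (l : 'I_(nedges (T K))) :
  continuous (derive1 f) -> (forall K, continuous (u K)) -> cell_set (T K') x ->
  `|dot (derive1 f (u K' x)) (normal l)| <= max_wave_speed f u.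
Proof.
move=> f'c uc K'x; apply: ub_le_sup; last by exists K', x, K, l.
pose g (i : 'I_(ncells T) * {K : 'I_(ncells T) & 'I_(nedges (T K))}) (x : point) :=
  `|dot (derive1 f (u i.1 x)) (normal (tagged i.2))|.
have /choice[B BP] : forall i, exists B, forall x, cell_set (T i.1) x -> g i x <= B.
  move=> i; have [|c _ cmax] := @EVT_max_rV R d (g i) (T i.1) (cell_neq0 _)
    (@cell_compact _ _ (T i.1)).
    apply: continuous_subspaceT => y.
    apply: (@continuous_comp _ _ _
      (fun y => dot (derive1 f (u i.1 y)) (normal (tagged i.2))) Num.norm);
      last exact: norm_continuous.
    apply: (@continuous_comp _ _ _ (fun y => derive1 f (u i.1 y)) (dot ^~ _));
      last exact: dot_continuous.
    by apply: continuous_comp; [exact: uc|exact: f'c].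
  by exists (g i c) => y Ky; apply: cmax; exact/mem_set.
have [M BM] := finite_ubound B.
exists M => _ [K1 [y [K2 [l2 [Ky ->]]]]].
apply: le_trans (BP (K1, Tagged _ l2) y Ky) _.
by apply: le_trans (BM _); exact: ler_norm.
Qed.

Lemma flux_lipschitz f u K (l : 'I_(nedges (T K))) x y :
  (forall w, derivable f w 1) -> continuous (derive1 f) ->
  (forall K, continuous (u K)) -> cell_set (T K) x -> cell_set (T K) y ->
  `|dot (f (u K y)) (normal l) - dot (f (u K x)) (normal l)| <=
  max_wave_speed f u * `|u K y - u K x|.
Proof.
move=> df f'c uc; wlog xy : x y / u K x <= u K y.
  move=> wlg Kx Ky; have [xy|/ltW yx] := leP (u K x) (u K y); first exact: wlg.
  by rewrite distrC (distrC (u K y)); exact: wlg.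
move=> Kx Ky; have dg w := is_derive_dot (normal l) (df w).
have [|c cxy ->] := MVT_segment xy (fun w _ => dg w).
  apply: continuous_subspaceT => w.
  exact/differentiable_continuous/derivable1_diffP.
rewrite normrM ler_wpM2r//.
(* The constant bounds the derivative only at values of [u]; the mean value point is one by
   connectedness of the cell. *)
have [z Kz <-] : exists2 z, cell_set (T K) z & u K z = c.
  rewrite cell_regular; apply: (@continuous_closure_itv _ _ _ _ x y).
  - exact: cell_connected.
  - exact: uc.
  - by rewrite -cell_regular.
  - by rewrite -cell_regular.
  - by move: cxy; rewrite in_itv.
exact: max_wave_speed_ge.
Qed.

(** Linearity is read off the point-value decomposition, which avoids integrability arguments. *)
Lemma cell_average_lin K (a b : R) (p q : point -> R) :
  polynomials (Z K) k p -> polynomials (Z K) k q ->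
  cell_average (T K) (fun x => a * p x + b * q x) =
  a * cell_average (T K) p + b * cell_average (T K) q.
Proof.
move=> hp hq; rewrite !(average_decomposition Q)//; last exact: polynomials_lin.
rewrite !mulrDr addrACA !mulr_sumr -!big_split; congr (_ + _); apply: eq_bigr => i _ /=.
  by rewrite mulrDr; congr (_ + _); rewrite mulrCA.
rewrite !mulr_sumr -big_split; apply: eq_bigr => j _ /=.
by rewrite mulrDr; congr (_ + _); rewrite mulrCA.
Qed.

(** The decomposition is applied to the constant 1, whose average is 1 as the cell has positive
    volume. *)
Lemma weights_sum1 K : \sum_(a < int_npts Q K) wI_int a +
  \sum_(l < nedges (T K)) \sum_(b < edge_npts Q l) wI_edge b = 1.
Proof.
have := average_decomposition Q (@polynomials_cst R d (Z K) k 1).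
rewrite /cell_average /volume_integral Rintegral_cst; last first.
  by apply: compact_row_measurable; exact: cell_compact.
rewrite mul1r mulVf; last by rewrite gt_eqF// volume_cell_gt0.
move=> ->; congr (_ + _); apply: eq_bigr => i _; first by rewrite mulr1.
by apply: eq_bigr => j _; rewrite mulr1.
Qed.

(** With the constant 1 as test function the gradient term vanishes. *)
Lemma local_divergence_average f u D K : is_local_divergence Q f u D ->
  cell_average (T K) (D K) = \sum_(l < nedges (T K)) edge_size l / volume (T K) *
    \sum_(b < edge_npts Q l) wB b * dot (f (u K (edge_pt b))) (normal l).
Proof.
move=> [_ /(_ (fun _ => cst 1))/(_ (fun K => polynomials_cst (Z K) k 1))/(_ K)].
rewrite {2}/volume_integral.
under [X in - X]eq_Rintegral => t _.
  have -> : gradient (d := d) (cst (1 : R)) (row_of_tuple t) = 0.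
    by apply/rowP => i; rewrite !mxE derive_cst.
  rewrite dot0r; over.
rewrite [X in - X]/Rintegral integral0/= oppr0 add0r => intD.
rewrite /cell_average.
have -> : volume_integral (T K) (D K) =
    volume_integral (T K) (fun x => D K x * cst 1 x).
  by congr volume_integral; apply/funext => x; rewrite mulr1.
rewrite intD mulr_sumr; apply: eq_bigr => l _.
rewrite /edge_quadrature mulrA (mulrC _^-1); congr (_ * _).
by apply: eq_bigr => b _; rewrite mulr1.
Qed.

(** The sign [s = 1] yields a minimum point and [s = -1] a maximum point. *)
Lemma stencil_extremum (s : R) (B : set R) K u : valued_on_SK Q B K u ->
  exists x, [/\ cell_set (T K) x, B (u K x),
    forall a : 'I_(int_npts Q K), s * u K x <= s * u K (int_pt a) &
    forall (l : 'I_(nedges (T K))) (b : 'I_(edge_npts Q l)),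
      s * u K x <= s * u K (edge_pt b)].
Proof.
move=> [uI uE].
pose I := ('I_(int_npts Q K) + {l : 'I_(nedges (T K)) & 'I_(edge_npts Q l)})%type.
pose pt (i : I) := match i with
  | inl a => int_pt a
  | inr j => edge_pt (tagged j)
  end.
(* An empty stencil would make the weights sum to 0 instead of 1. *)
have [i0 _] : exists i : I, true.
  apply: contrapT => noI; have := weights_sum1 K.
  rewrite !big1 ?addr0 => [/eqP|l _|a _]; first by rewrite eq_sym oner_eq0.
    rewrite big1// => b _; case: noI.
    by exists (inr (@Tagged _ l (fun l => 'I_(edge_npts Q l)) b)).
  by case: noI; exists (inl a).
case: (arg_minP (fun i => s * u K (pt i)) (isT : xpredT i0)) => i _ imin.
exists (pt i); split.
- case: i {imin} => [a|j]; first exact: int_ptP.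
  exact/edge_sub/edge_ptP.
- by case: i {imin} => [a|j]; [exact: uI|exact: uE].
- by move=> a; exact: (imin (inl a)).
- by move=> l b; exact: (imin (inr (@Tagged _ l (fun l => 'I_(edge_npts Q l)) b))).
Qed.

Lemma edge_weight_bound f u dt K (l : 'I_(nedges (T K))) (b : 'I_(edge_npts Q l)) :
  continuous (derive1 f) -> (forall K, continuous (u K)) -> 0 < dt ->
  mesh_ratio T dt * max_wave_speed f u <= decomposition_constant Q ->
  dt * edge_size l / volume (T K) * `|wB b| * max_wave_speed f u <= wI_edge b.
Proof.
move=> f'c uc dt0 cfl.
have a0 : 0 <= max_wave_speed f u.
  have [x Kx] := cell_neq0 (T K).
  exact: le_trans (normr_ge0 _) (max_wave_speed_ge l f'c uc Kx).
have mu0 : 0 <= dt * edge_size l / volume (T K).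
  by rewrite divr_ge0 ?mulr_ge0 ?edge_size_ge0 ?ltW ?volume_cell_gt0.
have muc : dt * edge_size l / volume (T K) * max_wave_speed f u <= wI_edge b / wB b.
  apply: le_trans (decomposition_constant_le b); apply: le_trans cfl.
  by rewrite ler_wpM2r// mesh_ratio_ge.
have /andP[wI0 _] := wI_edge_itv b.
(* A negative [wB b] would make the ratio negative, against its nonnegative lower bound; for
   [wB b = 0] the left side vanishes. *)
rewrite mulrAC; have [wB0|wB0|->] := ltgtP (wB b) 0.
- have := le_trans (mulr_ge0 mu0 a0) muc.
  by rewrite leNgt pmulr_rlt0// invr_lt0 wB0.
- by rewrite gtr0_norm// -ler_pdivlMr.
- by rewrite normr0 mulr0 ltW.
Qed.

(** Here [s] selects minimum or maximum and [e] the sign of the update, so one estimate covers all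
    four bounds. *)
Lemma shifted_average_ge f u D dt (s e : R) K x :
  (forall w, derivable f w 1) -> continuous (derive1 f) ->
  dg_space k Z u -> is_local_divergence Q f u D -> 0 < dt ->
  mesh_ratio T dt * max_wave_speed f u <= decomposition_constant Q ->
  `|s| = 1 -> `|e| = 1 -> cell_set (T K) x ->
  (forall a : 'I_(int_npts Q K), s * u K x <= s * u K (int_pt a)) ->
  (forall (l : 'I_(nedges (T K))) (b : 'I_(edge_npts Q l)),
      s * u K x <= s * u K (edge_pt b)) ->
  s * u K x <=
  s * (cell_average (T K) (u K) + e * (dt * cell_average (T K) (D K))).
Proof.
move=> df f'c uV hD dt0 cfl s1 e1 Kx xa xb.
have uc K' : continuous (u K') by exact/polynomials_continuous/uV.
have -> : s * (cell_average (T K) (u K) + e * (dt * cell_average (T K) (D K))) =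
  \sum_(a < int_npts Q K) wI_int a * (s * u K (int_pt a)) +
  \sum_(l < nedges (T K)) \sum_(b < edge_npts Q l)
     wI_edge b * (s * u K (edge_pt b)) +
  \sum_(l < nedges (T K)) dt * edge_size l / volume (T K) *
    \sum_(b < edge_npts Q l) wB b *
      (s * e * dot (f (u K (edge_pt b))) (normal l)).
  rewrite (average_decomposition Q (uV K)) (local_divergence_average K hD) !mulrDr.
  congr (_ + _ + _).
  - by rewrite mulr_sumr; apply: eq_bigr => a _; rewrite mulrCA.
  - rewrite mulr_sumr; apply: eq_bigr => l _; rewrite mulr_sumr.
    by apply: eq_bigr => b _; rewrite mulrCA.
  - rewrite !mulr_sumr; apply: eq_bigr => l _; rewrite !mulr_sumr.
    by apply: eq_bigr => b _; ring.
apply: (@perturbed_average_ge R _ _ _ _ _ _ _ _ _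
  (fun l => s * e * dot (f (u K x)) (normal l))) => //.
- by move=> a; have /andP[/ltW] := wI_int_itv a.
- exact: weights_sum1.
- exact: wB_sum.
(* The flux of the constant vector [f (u K x)] through the closed surface is zero, coordinate by
   coordinate. *)
- transitivity (s * e * dt / volume (T K) *
      \sum_i f (u K x) ord0 i * \sum_(l < nedges (T K)) edge_size l * normal l ord0 i).
    rewrite mulr_sumr.
    under [RHS]eq_bigr do rewrite !mulr_sumr.
    rewrite exchange_big; apply: eq_bigr => l _.
    by rewrite /dot !mulr_sumr; apply: eq_bigr => i _; ring.
  by rewrite big1 ?mulr0// => i _; rewrite closed_surface mulr0.
- move=> l b.
  have mu0 : 0 <= dt * edge_size l / volume (T K).
    by rewrite divr_ge0 ?mulr_ge0 ?edge_size_ge0 ?ltW ?volume_cell_gt0.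
  have Kb : cell_set (T K) (edge_pt b) by exact/edge_sub/edge_ptP.
  (* Extremality of [x] gives the difference its sign, which turns it into the absolute value in the
     Lipschitz bound. *)
  have -> : s * u K (edge_pt b) - s * u K x = `|u K (edge_pt b) - u K x|.
    by rewrite -[RHS]mul1r -s1 -normrM mulrBr ger0_norm// subr_ge0.
  rewrite -mulrBr normrM (normrM (s * e)) (normrM s) s1 e1 !mul1r.
  rewrite normrM (ger0_norm mu0).
  apply: le_trans (ler_wpM2r (normr_ge0 _) (edge_weight_bound b f'c uc dt0 cfl)).
  by rewrite -[leRHS]mulrA ler_wpM2l ?(mulr_ge0 mu0)//; exact: flux_lipschitz.
Qed.

End Scheme.

Theorem lemma3p1 (R : realType) (d : nat) (hd : (0 < d)%N)
  (Omega : set 'rV[R]_d) (hOmega : open Omega) (T : mesh Omega)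
  (k : nat) (hk : (1 <= k)%N) (Z : 'I_(ncells T) -> degree_kind)
  (Q : quadrature k Z)
  (f : R -> 'rV[R]_d)
  (hf : forall w : R, derivable f w 1) (hf' : continuous (derive1 f))
  (m M : R) (dt : R) (hdt : 0 < dt)
  (u G : dg_function T) (hu : dg_space k Z u)
  (hG : is_local_derivative_operator Q f u G)
  (hCFL : mesh_ratio T dt * max_wave_speed f u <= decomposition_constant Q) :
  forall K : 'I_(ncells T),
    valued_on_SK Q `[m, M] K u ->
    cell_average (T K) (fun x => u K x + dt * G K x) \in `[m, M] /\
    cell_average (T K) (fun x => u K x - dt * G K x) \in `[m, M].
Proof.
move=> K uB; have [D hD ->] := hG; have [DV _] := hD.
(* As [G] is [- D], the update with plus sign is [e = -1] and the one with minus sign is [e = 1]. *)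
have avg_in (e : R) : `|e| = 1 ->
    cell_average (T K) (u K) + e * (dt * cell_average (T K) (D K)) \in `[m, M].
  move=> e1; rewrite in_itv/=; apply/andP; split.
    have [x [Kx]] := stencil_extremum 1 uB.
    rewrite /= in_itv/= => /andP[mx _] xa xb; apply: le_trans mx _.
    have := shifted_average_ge hf hf' hu hD hdt hCFL (normr1 R) e1 Kx xa xb.
    by rewrite !mul1r.
  (* The upper bound is the lower bound for the negated values, taken at a maximum point. *)
  have [x [Kx]] := stencil_extremum (- 1) uB.
  rewrite /= in_itv/= => /andP[_ xM] xa xb; apply: le_trans _ xM.
  have := shifted_average_ge hf hf' hu hD hdt hCFL (normrN1 R) e1 Kx xa xb.
  by rewrite !mulN1r lerN2.
have avgE (e : R) : cell_average (T K) (fun x => u K x + e * (dt * D K x)) =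
    cell_average (T K) (u K) + e * (dt * cell_average (T K) (D K)).
  rewrite mulrA -[X in X + _]mul1r -(cell_average_lin Q)//.
  by congr cell_average; apply/funext => x; rewrite mul1r mulrA.
split.
  rewrite (_ : (fun _ => _) = fun x => u K x + -1 * (dt * D K x)).
    by rewrite avgE avg_in// normrN1.
  by apply/funext => x; rewrite mulN1r mulrN.
rewrite (_ : (fun _ => _) = fun x => u K x + 1 * (dt * D K x)).
  by rewrite avgE avg_in// normr1.
by apply/funext => x; rewrite mul1r mulrN opprK.
Qed.
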